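(* Let $Q$ be a polynomial ring over a field and let $I$ be an ideal of $Q$ minimally generated by monomials $m_1,\dots,m_q$. Let $2\le l<q$ and let $i_1<\cdots<i_l$ be elements of $\{1,\dots,q\}$. Then the pivot complex $\mathcal{T}_{i_1,\dots,i_l}$ is a resolution of $Q/I$ if and only if there exists an index $h\in\{1,2,\dots,q\}\setminus\{i_1,\dots,i_l\}$ such that $m_h\mid\operatorname{lcm}(m_{i_1},\dots,m_{i_l})$.
   Context: Notation. $[q]=\{1,\dots,q\}$, $\mathcal{P}([q])$ is its power set. For $A\subseteq[q]$ put $m_A=\operatorname{lcm}(m_i : i\in A)$, with $m_\emptyset=1$. Taylor resolution. $\mathcal{T}$ is the complex of free $Q$-modules whose degree-$i$ component has basis $\{\epsilon_\tau : \tau\in\mathcal{P}([q]),\ |\tau|=i\}$, with differential $\partial(\epsilon_\tau)=\sum_{j\in\tau}(-1)^{|\{k\in\tau : k<j\}|}\frac{m_\tau}{m_{\tau\setminus\{j\}}}\epsilon_{\tau\setminus\{j\}}$. It is a free resolution of $Q/I$. Pivot complex. For $l\ge2$ and $i_1<\dots<i_l$ in $[q]$, the pivot complex $\mathcal{T}_{i_1,\dots,i_l}$ is the subcomplex of $\mathcal{T}$ spanned over $Q$ by the $\epsilon_\sigma$ with $\sigma\in\mathcal{P}([q])$ and $\sigma\nsupseteq\{i_1,\dots,i_l\}$. It is a resolution of $Q/I$ if $H_0=Q/I$ and $H_i=0$ for all $i>0$. *)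

(* Defs.v *)
From mathcomp Require Import all_boot all_order all_algebra.
From mathcomp.multinomials Require Export mpoly.

Set Implicit Arguments.
Unset Strict Implicit.
Unset Printing Implicit Defensive.

Import GRing.Theory.
Local Open Scope ring_scope.

Section Taylor.

Variables (k : fieldType) (n q : nat).
Local Notation Q := {mpoly k[n]}.

(* A monomial of Q is given by its exponent vector in 'X_{1..n}; the
   corresponding element of Q is 'X_[_].  The indices 1, ..., q are shifted to
   0, ..., q-1. *)
Variable m : 'I_q -> 'X_{1..n}.

Definition in_gen_ideal (A : {set 'I_q}) (f : Q) : Prop :=
  exists c : 'I_q -> Q, f = \sum_(i in A) c i * 'X_[m i].

Definition minimally_generated (I : Q -> Prop) : Prop :=
  (forall f, I f <-> in_gen_ideal [set: 'I_q] f) /\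
  (forall A : {set 'I_q}, A \proper [set: 'I_q] ->
     ~ (forall f, I f <-> in_gen_ideal A f)).

Definition lcm_mnm (A : {set 'I_q}) : 'X_{1..n} :=
  \big[@mlcm n/0%MM]_(i in A) m i.

(* The total module of the Taylor complex, i.e. the direct sum of its
   components: the free Q-module on all subsets of 'I_q.  The ^o makes *: the
   scaling by elements of Q rather than by elements of k. *)
Local Notation taylor := {ffun {set 'I_q} -> Q^o}.

Definition eps (s : {set 'I_q}) : taylor := [ffun t => (t == s)%:R].

(* lcm_mnm (t :\ j) divides lcm_mnm t, so the truncated difference of exponents
   is the exponent vector of the quotient of the two monomials. *)
Definition taylor_diff_eps (t : {set 'I_q}) : taylor :=
  \sum_(j in t)
    ((-1) ^+ #|[set i in t | (i < j)%N]|
       * 'X_[(lcm_mnm t - lcm_mnm (t :\ j))%MM] : Q) *: eps (t :\ j).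

Definition taylor_diff (x : taylor) : taylor :=
  \sum_(t : {set 'I_q}) (x t : Q) *: taylor_diff_eps t.

(* Degree d component of the span of the eps s, s \in S. *)
Definition chain (S : {set {set 'I_q}}) (d : nat) (x : taylor) : Prop :=
  forall s, x s != 0 -> (s \in S) && (#|s| == d).

Definition cycle (S : {set {set 'I_q}}) (d : nat) (x : taylor) : Prop :=
  chain S d x /\ taylor_diff x = 0.

Definition boundary (S : {set {set 'I_q}}) (d : nat) (x : taylor) : Prop :=
  exists y, chain S d.+1 y /\ taylor_diff y = x.

(* H_0 = Q/I says that f |-> [f *: eps set0] is a well-defined map from Q to
   H_0 = (chains of degree 0) / (boundaries of degree 0), is surjective, and
   has kernel I. *)
Definition H0_is_quotient (S : {set {set 'I_q}}) (I : Q -> Prop) : Prop :=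
  [/\ forall f : Q, chain S 0 (f *: eps set0),
      forall x, chain S 0 x ->
        exists f : Q, boundary S 0 (x - f *: eps set0)
    & forall f : Q, boundary S 0 (f *: eps set0) <-> I f].

Definition is_resolution (S : {set {set 'I_q}}) (I : Q -> Prop) : Prop :=
  H0_is_quotient S I /\
  (forall d x, (0 < d)%N -> cycle S d x -> boundary S d x).

End Taylor.

Definition pivot_faces (q : nat) (P : {set 'I_q}) : {set {set 'I_q}} :=
  [set s : {set 'I_q} | ~~ (P \subset s)].

(* Main.v *)
(* In multidegree [a] the Taylor complex is the augmented chain complex of the
   full simplex on V_a = {i : m_i | a}, and the pivot complex is the part on the
   faces not containing P = {i_1, ..., i_l}. If some m_h with [h] outside P
   divides lcm(P), these faces always form a cone as soon as V_a is nonempty: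
   either m_h | a and [h] is an apex, or P is not contained in V_a and any vertex
   is. Conversely, without such an [h], V_a = P for a = lcm(P), so the strand is
   the boundary of a simplex and d(eps P) is a cycle that does not bound. *)
Require Import Defs.
From mathcomp Require Import all_boot all_order all_algebra.
From mathcomp Require Import zify.

Set Implicit Arguments.
Unset Strict Implicit.
Unset Printing Implicit Defensive.

Import GRing.Theory.
Local Open Scope ring_scope.

(** * Boundary operator and cones on the augmented full simplex *)

Section Simplex.

Variables (R : comPzRingType) (q : nat).
Implicit Types (z w : {set 'I_q} -> R) (s t P : {set 'I_q}) (i j v : 'I_q).

Definition incidence j s : R := (-1) ^+ #|[set i in s | (i < j)%N]|.

(** The simplicial boundary, written on coefficient functions: the value at [s] collects the faces
    that have [s] as a facet. Faces of all sizes are kept together, the empty one included, so the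
    complex is augmented. *)
Definition simplex_diff z s : R :=
  \sum_(j | j \notin s) incidence j s * z (j |: s).

(** The join with [v], in coefficient form; the values of [z] on faces already containing [v] are
    discarded. *)
Definition cone v z s : R :=
  if v \in s then incidence v (s :\ v) * z (s :\ v) else 0.

Lemma incidence_sqr j s : incidence j s * incidence j s = 1.
Proof. by rewrite -expr2 sqrr_sign. Qed.

Lemma incidenceU1 i j s : i \notin s ->
  incidence j (i |: s) = (-1) ^+ (i < j)%N * incidence j s.
Proof.
move=> iNs; rewrite /incidence; have [ij|ji] := boolP (i < j)%N.
  have -> : [set x in i |: s | (x < j)%N] = i |: [set x in s | (x < j)%N].
    by apply/setP=> x; rewrite !inE; have [->|//] := eqVneq x i; rewrite ij.
  by rewrite cardsU1 inE (negbTE iNs) exprD.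
rewrite mul1r; congr (_ ^+ _); apply: eq_card => x; rewrite !inE.
by have [->|//] := eqVneq x i; rewrite (negbTE ji) (negbTE iNs).
Qed.

(** Inserting one vertex shifts the position of the other exactly when it is the smaller one.
    Exactly one of [i < j] and [j < i] holds, which gives a single extra sign. *)
Lemma incidence_anticomm i j s : i != j -> i \notin s -> j \notin s ->
  incidence j (i |: s) * incidence i (j |: s) = - (incidence i s * incidence j s).
Proof.
move=> ij iNs jNs; rewrite !incidenceU1 // mulrACA [X in _ * X = _]mulrC -[RHS]mulN1r.
congr (_ * _); case: (ltngtP (i : nat) j) => [||/val_inj eij]; rewrite ?mulr1 ?mul1r //.
by rewrite eij eqxx in ij.
Qed.

Lemma eq_simplex_diff z w : z =1 w -> simplex_diff z =1 simplex_diff w.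
Proof. by move=> zw s; apply: eq_bigr => j _; rewrite zw. Qed.

Lemma simplex_diffB z w s :
  simplex_diff (fun t => z t - w t) s = simplex_diff z s - simplex_diff w s.
Proof. by rewrite -sumrB; apply: eq_bigr => j _; rewrite mulrBr. Qed.

Lemma simplex_diff0 s : simplex_diff (fun=> 0) s = 0.
Proof. by rewrite /simplex_diff big1 // => j _; rewrite mulr0. Qed.

Lemma eq_cone v z w : z =1 w -> cone v z =1 cone v w.
Proof. by move=> zw s; rewrite /cone zw. Qed.

Lemma cone0 v s : cone v (fun=> 0) s = 0.
Proof. by rewrite /cone mulr0 if_same. Qed.

(** Coning is a contracting homotopy: [d cone + cone d = id], in every degree because the empty face
    is present. In particular the cone over a cycle bounds it. *)
Lemma simplex_diff_cone v z s :
  simplex_diff (cone v z) s = z s - cone v (simplex_diff z) s.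
Proof.
suff <- : simplex_diff (cone v z) s + cone v (simplex_diff z) s = z s.
  by rewrite addrK.
rewrite {2}/cone; case: ifPn => [vs|vNs]; last first.
  rewrite addr0 /simplex_diff (bigD1 v) //= big1 => [|j /andP[jNs jv]].
    by rewrite /cone setU11 setU1K // mulrA incidence_sqr mul1r addr0.
  by rewrite /cone !inE eq_sym (negbTE jv) (negbTE vNs) mulr0.
have sv j : j \notin s -> j != v by apply: contraNneq => ->.
(* For [v \in s], the summand [j = v] of the inner boundary returns [z s]; the other summands cancel
   in pairs by [incidence_anticomm]. *)
rewrite /simplex_diff [X in _ + _ * X](bigD1 v) ?setD11 //=.
rewrite setD1K // mulrDr mulrA incidence_sqr mul1r addrCA.
rewrite -[RHS]addr0; congr (_ + _); rewrite mulr_sumr.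
rewrite [X in _ + X](eq_bigl (fun j => j \notin s)); last first.
  move=> j; rewrite !inE; have [->|] := eqVneq j v; rewrite ?vs //=.
  by rewrite andbT.
rewrite -big_split big1 //= => j jNs; have jv := sv _ jNs.
rewrite /cone !inE vs orbT.
have -> : (j |: s) :\ v = j |: s :\ v.
  by apply/setP=> x; rewrite !inE; have [->|] := eqVneq x j; rewrite ?jv.
rewrite !mulrA -mulrDl -{1}(setD1K vs) incidence_anticomm ?setD11 1?eq_sym //.
  by rewrite addNr mul0r.
by rewrite !inE negb_and jNs orbT.
Qed.

(* A function supported on [P] with [v \in P] is the cone of a function
   supported on [P :\ v], and [dd (cone w) = cone (dd w)]. *)
Lemma simplex_diff_diff_supp1 P z :
  (forall s, s != P -> z s = 0) -> forall s, simplex_diff (simplex_diff z) s = 0.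
Proof.
have [d] := ubnP #|P|; elim: d P z => // d IH P z cardP zP s.
have [P0|[v vP]] := set_0Vmem P.
  rewrite (eq_simplex_diff (w := fun=> 0)) ?simplex_diff0 // => t.
  rewrite /simplex_diff big1 // => j _; rewrite zP ?mulr0 // P0.
  by apply/set0Pn; exists j; rewrite setU11.
pose w t := if t == P :\ v then incidence v (P :\ v) * z P else 0.
have zw : z =1 cone v w.
  move=> t; rewrite /cone /w; have [->|tP] := eqVneq t P.
    by rewrite vP eqxx mulrA incidence_sqr mul1r.
  rewrite zP //; case: ifP => // vt; case: eqP => [tvP|]; last by rewrite mulr0.
  by rewrite -(setD1K vt) tvP setD1K ?eqxx in tP.
have ddw t : simplex_diff (simplex_diff w) t = 0.
  apply: (IH (P :\ v)) => [|u uP]; last by rewrite /w (negbTE uP).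
  by rewrite (cardsD1 v P) vP ltnS in cardP.
rewrite (eq_simplex_diff (eq_simplex_diff zw)).
rewrite (eq_simplex_diff (simplex_diff_cone v w)) simplex_diffB simplex_diff_cone.
by rewrite opprB addrC subrK (eq_cone _ ddw) cone0.
Qed.

End Simplex.

Lemma mcoeffXM (R : comNzRingType) n (c b : 'X_{1..n}) (p : {mpoly R[n]}) :
  ('X_[c] * p)@_b = if (c <= b)%MM then p@_(b - c) else 0.
Proof.
rewrite mulrC; case: ifPn => [cb|cNb].
  by rewrite -{1}(submK cb) addmC mcoeffMX.
apply/eqP; rewrite mcoeff_eq0 (perm_mem (msuppMX p c)).
by apply: contra cNb => /mapP[b' _ ->]; rewrite lem_addr.
Qed.

(** * Multigraded strands of the Taylor complex *)

Section Strands.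

Variables (k : fieldType) (n q : nat) (m : 'I_q -> 'X_{1..n}).
Local Notation Q := {mpoly k[n]}.
Local Notation taylor := {ffun {set 'I_q} -> Q^o}.
Local Notation lcm := (lcm_mnm m).
Implicit Types (x y : taylor) (a b : 'X_{1..n}) (s t P : {set 'I_q}).

Lemma lcm_mnm_leP s a :
  reflect (forall i, i \in s -> (m i <= a)%MM) (lcm s <= a)%MM.
Proof.
rewrite /lcm_mnm (big_morph (fun b => (b <= a)%MM) (id1 := true) (op1 := andb)).
- by rewrite big_andE; apply: forall_inP.
- by move=> b c; rewrite lem_mlcm.
- by apply/mnm_lepP => i; rewrite mnm0E.
Qed.

Lemma lcm_mnm0 : lcm set0 = 0%MM.
Proof. by rewrite /lcm_mnm big_set0. Qed.

Lemma lcm_mnm1 i : lcm [set i] = m i.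
Proof.
apply/mnmP => j; apply/anti_leq/andP; split; move: j; apply/mnm_lepP.
  by apply/lcm_mnm_leP => j /set1P->; apply: lepm_refl.
by apply: (lcm_mnm_leP _ _ (lepm_refl _)); rewrite set11.
Qed.

Lemma lcm_mnmS s t : s \subset t -> (lcm s <= lcm t)%MM.
Proof.
move=> /subsetP st; apply/lcm_mnm_leP => i /st.
by move: i; apply/lcm_mnm_leP/lepm_refl.
Qed.

Lemma lcm_mnm_leU1 i s a : (lcm (i |: s) <= a)%MM = (m i <= a)%MM && (lcm s <= a)%MM.
Proof.
apply/lcm_mnm_leP/andP => [sa|[ia /lcm_mnm_leP sa] j].
  by split; [|apply/lcm_mnm_leP => j js]; apply: sa; rewrite !inE ?eqxx ?js ?orbT.
by case/setU1P=> [->|/sa].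
Qed.

(** The pairs [j \in t] with [t :\ j = s] are those with [t = j |: s] and [j \notin s]. The sign may
    be counted in [s] instead of [t], since [j] is not below itself. *)
Lemma taylor_diffE x s : taylor_diff m x s =
  \sum_(j | j \notin s)
    incidence {mpoly k[n]} j s * ('X_[lcm (j |: s) - lcm s] * (x (j |: s) : Q)).
Proof.
rewrite /taylor_diff sum_ffunE /=.
transitivity (\sum_(t : {set 'I_q}) \sum_(j in t) if t :\ j == s then (incidence Q j s *
  ('X_[lcm t - lcm s] * (x t : Q))) else 0).
  apply: eq_bigr => t _; rewrite ffunE /taylor_diff_eps sum_ffunE /= scaler_sumr.
  apply: eq_bigr => j jt; rewrite !ffunE eq_sym /GRing.scale /=.
  case: eqVneq => [<-|_]; rewrite ?mulr0 // mulr1 mulrC -mulrA.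
  congr (_ ^+ _ * _); apply: eq_card => i; rewrite !inE.
  by case: (eqVneq i j) => [->|//]; rewrite ltnn andbF.
rewrite (exchange_big_dep predT) //= [RHS]big_mkcond; apply: eq_bigr => j _.
rewrite -big_mkcondr /=; case: ifPn => js.
  rewrite (big_pred1 (j |: s)) // => t /=; apply/andP/eqP => [[jt /eqP<-]|->].
    by rewrite setD1K.
  by rewrite setU11 setU1K.
rewrite big_pred0 // => t; apply/negP => /andP[_ /eqP ts].
by rewrite -ts setD11 in js.
Qed.

(* The multidegree-[a] part of [x], as a function on the faces of the simplex. *)
Definition strand a x s : k :=
  if (lcm s <= a)%MM then (x s : Q)@_(a - lcm s) else 0.

(** Multiplication by the monomial [lcm (j |: s) / lcm s] moves the coefficient at
    [a - lcm (j |: s)] to [a - lcm s], so within one multidegree only the signs remain. *)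
Lemma strand_diff a x s :
  strand a (taylor_diff m x) s = simplex_diff (strand a x) s.
Proof.
rewrite /strand taylor_diffE; case: ifPn => [sa|sNa]; last first.
  rewrite /simplex_diff big1 // => j _.
  by rewrite lcm_mnm_leU1 (negbTE sNa) andbF mulr0.
rewrite raddf_sum; apply: eq_bigr => j _; rewrite /incidence /=.
rewrite -signr_odd -[in RHS]signr_odd !mulr_sign.
have E : ('X_[lcm (j |: s) - lcm s] * (x (j |: s) : Q))@_(a - lcm s) =
    if (lcm (j |: s) <= a)%MM then (x (j |: s) : Q)@_(a - lcm (j |: s)) else 0.
  have sj : (lcm s <= lcm (j |: s))%MM by apply/lcm_mnmS/subsetUr.
  have -> : (a - lcm (j |: s) = a - lcm s - (lcm (j |: s) - lcm s))%MM.
    apply/mnmP => i; move: (mnm_lepP sa i) (mnm_lepP sj i).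
    by rewrite !mnmBE; lia.
  (* Since [lcm s] divides both [a] and [lcm (j |: s)], no subtraction truncates and the two
     divisibility conditions agree. *)
  rewrite mcoeffXM; set b1 := (_ <= _)%MM; set b2 := (_ <= a)%MM.
  suff -> : b1 = b2 by [].
  by apply/mnm_lepP/mnm_lepP => sja i;
    move: (sja i) (mnm_lepP sa i) (mnm_lepP sj i); rewrite !mnmBE; lia.
by case: odd; [rewrite mcoeffN; congr (- _)|]; apply: E.
Qed.

Lemma strand_inj x y : (forall a s, strand a x s = strand a y s) -> x = y.
Proof.
move=> xy; apply/ffunP => s; apply/mpolyP => b.
by have := xy (b + lcm s)%MM s; rewrite /strand lem_addl addmK.
Qed.

Lemma strand_neq0 a x s : strand a x s != 0 -> (lcm s <= a)%MM /\ x s != 0.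
Proof.
rewrite /strand; case: ifP => [_|]; last by rewrite eqxx.
by move=> xs; split=> //; apply: contraNneq xs => ->; rewrite mcoeff0.
Qed.

(** Each of the finitely many coefficients is a polynomial. This finiteness is what allows strands
    built one at a time to be glued into a chain. *)
Lemma strand_bound x : exists D, forall a s, strand a x s != 0 -> (mdeg a < D)%N.
Proof.
exists (\max_s (msize (x s : Q) + mdeg (lcm s)))%N => a s xs.
have [sa _] := strand_neq0 xs; move: xs; rewrite /strand sa -mcoeff_msupp.
move=> /msize_mdeg_lt xs; rewrite -(submK sa) mdegD.
by apply: leq_trans (leq_bigmax s); rewrite -addSn leq_add2r.
Qed.

Lemma taylor_of_strands (z : 'X_{1..n} -> {set 'I_q} -> k) D :
    (forall a s, z a s != 0 -> (lcm s <= a)%MM && (mdeg a < D)%N) ->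
  exists y, forall a s, strand a y s = z a s.
Proof.
move=> zD; have z0 a s : ~~ ((lcm s <= a)%MM && (mdeg a < D)%N) -> z a s = 0.
  by move=> aD; apply: contraNeq aD => /zD.
(* Truncating at degree [D] loses nothing, because [mdeg (a - lcm s) <= mdeg a]. *)
exists [ffun s => \sum_(b : 'X_{1..n < D}) z (b + lcm s)%MM s *: 'X_[b]] => a s.
rewrite /strand ffunE; case: ifPn => [sa|sNa]; last by rewrite z0 // (negbTE sNa).
have [aD|Da] := ltnP (mdeg (a - lcm s)) D.
  by rewrite (mcoeff_mpoly (fun b => z (b + lcm s)%MM s)) // submK.
rewrite raddf_sum big1 /= => [|b _]; last first.
  rewrite mcoeffZ mcoeffX; case: eqP => [eb|_]; last by rewrite mulr0.
  by have := bmdeg b; rewrite eb ltnNge Da.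
rewrite z0 // negb_and -leqNgt -(submK sa) mdegD.
by rewrite (leq_trans Da) ?orbT ?leq_addr.
Qed.

Lemma strand0 a s : strand a 0 s = 0.
Proof. by rewrite /strand ffunE mcoeff0 if_same. Qed.

Lemma strand_eps a s t : t != s -> strand a (eps k n s) t = 0.
Proof. by move=> ts; rewrite /strand ffunE (negbTE ts) mcoeff0 if_same. Qed.

(** Every strand of [eps s] is supported on the single face [s], so [simplex_diff_diff_supp1]
    applies in each multidegree. *)
Lemma taylor_diff_diff_eps s : taylor_diff m (taylor_diff m (eps k n s)) = 0.
Proof.
apply: strand_inj => a t; rewrite strand_diff (eq_simplex_diff (strand_diff a _)).
by rewrite strand0 (simplex_diff_diff_supp1 (@strand_eps a s)).
Qed.

(** * Homology of the pivot complex *)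

Lemma pivot_H0_is_quotient (I : Q -> Prop) P :
    (forall f, I f <-> in_gen_ideal m [set: 'I_q] f) -> (1 < #|P|)%N ->
  H0_is_quotient m (pivot_faces P) I.
Proof.
move=> Igen P_gt1.
(* As [P] has at least two elements, the pivot and Taylor complexes agree in degrees 0 and 1. *)
have small s : (#|s| <= 1)%N -> s \in pivot_faces P.
  by rewrite inE => s1; apply/negP => /subset_leq_card; rewrite leqNgt (leq_ltn_trans s1).
have diff0 y : taylor_diff m y set0 = \sum_i (y [set i] : Q) * 'X_[m i].
  rewrite taylor_diffE; apply: eq_big => [i|i _]; rewrite ?inE // setU0.
  rewrite lcm_mnm0 lcm_mnm1 subm0 mulrC /incidence; set A := finset _.
  suff -> : A = set0 by rewrite cards0 mulr1 mulrC.
  by apply/setP => j; rewrite !inE.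
split=> [f s|x x0|f].
- rewrite !ffunE; have [->|] := eqVneq s set0; last by rewrite scaler0 eqxx.
  by rewrite small cards0.
- exists (x set0), 0; split=> [s|]; first by rewrite ffunE eqxx.
  rewrite /taylor_diff big1 => [|t _]; last by rewrite ffunE scale0r.
  apply/ffunP => s; rewrite !ffunE; have [->|s0] := eqVneq s set0.
    by rewrite /GRing.scale /= mulr1 subrr.
  rewrite scaler0 subr0; apply/esym/eqP; apply: contraNT s0 => /x0.
  by rewrite cards_eq0 => /andP[].
rewrite Igen; split=> [[y [_ yf]]|[c ->]].
  exists (fun i => y [set i]); rewrite (eq_bigl predT) => [|i]; last by rewrite inE.
  by rewrite -diff0 yf !ffunE eqxx /GRing.scale /= mulr1.
(* The degree 1 chain with coefficient [c i] on the vertex [[set i]]; the sum has at most one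
   nonzero term. *)
pose y : taylor := [ffun s => \sum_i if s == [set i] then c i else 0].
have y1 i : y [set i] = c i.
  rewrite ffunE (bigD1 i) //= eqxx big1 ?addr0 // => j ji.
  by rewrite (inj_eq set1_inj) eq_sym (negbTE ji).
have yN1 s : y s != 0 -> #|s| == 1%N.
  rewrite ffunE; apply: contraR => s1; rewrite big1 // => i _.
  by case: (eqVneq s [set i]) s1 => // ->; rewrite cards1.
exists y; split=> [s /yN1 s1|]; first by rewrite s1 small // (eqP s1).
apply/ffunP => s; rewrite !ffunE; have [->|s0] := eqVneq s set0.
  rewrite diff0 /GRing.scale /= mulr1; apply: eq_big => [i|i _]; rewrite ?inE //.
  by rewrite y1.
rewrite scaler0 taylor_diffE big1 // => j js; have [->|/yN1] := eqVneq (y (j |: s)) 0.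
  by rewrite !mulr0.
by rewrite cardsU1 js eqSS cards_eq0 (negbTE s0).
Qed.

(** A filling of [x] is obtained by coning each strand from an apex that depends on the multidegree,
    then gluing the results. *)
Lemma pivot_exact P h d x : h \notin P -> (m h <= lcm P)%MM -> (0 < d)%N ->
  Defs.cycle m (pivot_faces P) d x -> boundary m (pivot_faces P) d x.
Proof.
move=> hNP hP d_gt0 [xS dx0].
pose apex a := if (m h <= a)%MM then Some h else [pick i | (m i <= a)%MM].
have apex_le a v : apex a = Some v -> (m v <= a)%MM.
  by rewrite /apex; case: ifPn => [ha [<-]//|_]; case: pickP => // i ia [<-].
pose z a s := if apex a is Some v then cone v (strand a x) s else 0.
have zP a s : z a s != 0 -> exists v,
    [/\ apex a = Some v, v \in s & strand a x (s :\ v) != 0].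
  rewrite /z; case: (apex a) => [v|]; last by rewrite eqxx.
  rewrite /cone; case: ifP => [vs zas|]; last by rewrite eqxx.
  by exists v; split=> //; apply: contraNneq zas => ->; rewrite mulr0.
have z_le a s : z a s != 0 -> (lcm s <= a)%MM.
  move=> /zP[v [/apex_le va vs /strand_neq0[sva _]]].
  by rewrite -(setD1K vs) lcm_mnm_leU1 va.
have [D xD] := strand_bound x.
have [a s zas|y yz] := @taylor_of_strands z D.
  by rewrite z_le //; have [v [_ _ /xD]] := zP _ _ zas.
exists y; split=> [s ys|].
  have [a zas] : exists a, z a s != 0.
    have [b yb] : exists b, (y s : Q)@_b != 0.
      by exists (mlead (y s : Q)); rewrite mleadc_eq0.
    by exists (b + lcm s)%MM; rewrite -yz /strand lem_addl addmK.
  have sa := z_le _ _ zas; have [v [av vs /strand_neq0[_ /xS]]] := zP _ _ zas.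
  rewrite !inE => /andP[PNsv /eqP <-]; rewrite (cardsD1 v s) vs eqxx andbT.
  (* If [P \subset s], then [lcm P], hence [m h], divides [a], so the apex [v] is [h]. As
     [h \notin P], already [s :\ v] contains [P], although [x] is a pivot chain. *)
  apply: contra PNsv => Ps; move: av; rewrite /apex.
  rewrite (lepm_trans hP) ?(lepm_trans (lcm_mnmS Ps)) // => -[<-].
  by rewrite subsetD1 Ps.
apply: strand_inj => a s; rewrite strand_diff (eq_simplex_diff (yz a)) /z.
case Ea: (apex a) => [v|].
  rewrite simplex_diff_cone (eq_cone v (w := fun=> 0)) ?cone0 ?subr0 // => t.
  by rewrite -strand_diff dx0 strand0.
(* Without an apex no [m i] divides [a], so the strand of [x] could only live on the empty face,
   which [0 < d] excludes. *)
rewrite simplex_diff0; apply/esym/eqP; apply: contraTT d_gt0.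
move=> /strand_neq0[sa /xS/andP[_ /eqP <-]]; rewrite -leqNgt leqn0 cards_eq0.
apply/eqP/setP => i; rewrite inE; apply/negP => /(lcm_mnm_leP _ _ sa) ia.
by move: Ea; rewrite /apex; case: ifP => // _; case: pickP => // /(_ i); rewrite ia.
Qed.

(** Without such an [h], a filling of the boundary of [eps P] would have zero strand in multidegree
    [lcm P], whereas that boundary does not vanish there. *)
Lemma pivot_not_exact P : (1 < #|P|)%N ->
    (forall d x, (0 < d)%N ->
      Defs.cycle m (pivot_faces P) d x -> boundary m (pivot_faces P) d x) ->
  exists h, h \notin P /\ (m h <= lcm P)%MM.
Proof.
move=> P_gt1 exact_P.
have [h /andP[hNP hP]|noh] := pickP [pred h | (h \notin P) && (m h <= lcm P)%MM].
  by exists h.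
have [v vP] : exists v, v \in P by apply/set0Pn; rewrite -card_gt0 ltnW.
have cardP : #|P| = #|P :\ v|.+1 by rewrite (cardsD1 v P) vP.
case: (exact_P #|P :\ v| (taylor_diff m (eps k n P))) => [||y [yS dy]].
- by move: P_gt1; rewrite cardP.
- split; last exact: taylor_diff_diff_eps.
  move=> s; rewrite taylor_diffE => nz.
  have [j /andP[js /eqP jsP]] : exists j, (j \notin s) && (j |: s == P).
    apply/existsP; apply: contraNT nz => /existsPn no; apply/eqP.
    rewrite big1 // => j js; rewrite ffunE.
    by have := no j; rewrite js /= => /negbTE->; rewrite !mulr0.
  by rewrite inE -eqSS -cardP -jsP subUset sub1set (negbTE js) cardsU1 js /=.
(* A face with nonzero value has all its vertices in [P] and as many elements as [P], so it is [P]
   itself, which is not a pivot face. *)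
have y0 t : strand (lcm P) y t = 0.
  apply/eqP/negPn/negP => /strand_neq0[tP /yS]; rewrite inE => /andP[PNt /eqP tc].
  have tsP : t \subset P.
    apply/subsetP => i /(lcm_mnm_leP _ _ tP) iP.
    by have /= := noh i; rewrite iP andbT => /negbFE.
  suff tP' : t = P by rewrite tP' subxx in PNt.
  by apply/eqP; rewrite eqEcard tsP tc cardP /=.
(* At the facet [P :\ v] the filling gives 0, while the boundary of [eps P] has a sign as its
   coefficient. *)
have := strand_diff (lcm P) y (P :\ v).
rewrite (eq_simplex_diff y0) simplex_diff0 dy strand_diff /simplex_diff.
rewrite (bigD1 v) ?setD11 //= setD1K // big1 => [|j /andP[jPv jv]]; last first.
  rewrite strand_eps ?mulr0 //; apply: contraNneq jv => jP.
  by move: vP; rewrite -jP !inE eqxx orbF eq_sym.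
rewrite addr0 /strand lepm_refl ffunE eqxx /= => /eqP.
have -> : (lcm P - lcm P = 0)%MM by apply/mnmP => i; rewrite mnmBE mnm0E subnn.
by rewrite mcoeff1 eqxx mulr1 signr_eq0.
Qed.

End Strands.

Theorem theorem1p2 (k : fieldType) (n q l : nat)
    (I : {mpoly k[n]} -> Prop) (m : 'I_q -> 'X_{1..n})
    (hI : minimally_generated m I)
    (hl : (2 <= l)%N) (hlq : (l < q)%N)
    (i : 'I_l -> 'I_q) (hi : forall a b : 'I_l, (a < b)%N -> (i a < i b)%N) :
  is_resolution m (pivot_faces [set i a | a : 'I_l]) I <->
  exists h : 'I_q,
    h \notin [set i a | a : 'I_l] /\
    (m h <= lcm_mnm m [set i a | a : 'I_l])%MM.
Proof.
have i_inj : injective i.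
  move=> a b iab; apply/val_inj; case: (ltngtP (a : nat) b) => // /hi;
  by rewrite iab ltnn.
(* Injectivity of [i] makes the pivot set have exactly [l] elements, and [2 <= l]. *)
have P_gt1 : (1 < #|[set i a | a : 'I_l]|)%N by rewrite card_imset // card_ord.
split=> [[_ /(pivot_not_exact P_gt1)//]|[h [hNP hP]]].
split; first by apply: pivot_H0_is_quotient => //; case: hI.
by move=> d x d_gt0; apply: pivot_exact hP d_gt0.
Qed.
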